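(* Let $P$ be an irreducible, positive recurrent transition matrix of $M/G/1$ type with stationary distribution $\pi$, and fix $N\ge0$. Let $\pi^{(N)}$ be the unique stationary distribution of the censored matrix $P^{(N)}$. Let $M_0$ be such that the renormalized approximated censored matrix (RA-CM) $\widetilde P^{(N;M)}$ is irreducible for all $M\ge M_0$ (such an $M_0<\infty$ exists), and for $M\ge M_0$ let $\widetilde\pi^{(N:M)}$ be the unique stationary distribution of $\widetilde P^{(N;M)}$. Then $$\bigl\|\widetilde\pi^{(N:M)}-\pi^{(N)}\bigr\|_1\longrightarrow 0\qquad(M\to\infty).$$ Moreover, with $\Delta^{(M)}=\widetilde P^{(N;M)}-P^{(N)}=(0,\dots,0,\ \widetilde C_N^{(M)}-C_N^{(\infty)})$, for $M\ge M_0$: $$\bigl\|\widetilde\pi^{(N:M)}-\pi^{(N)}\bigr\|_1\le\|\Delta^{(M)}\|_{1\to1}\,\|Z_N\|_{1\to1},\qquad Z_N=\bigl(I-P^{(N)}+\mathbf 1\pi^{(N)}\bigr)^{-1},$$ $$\|\Delta^{(M)}\|_{\infty\to\infty}=\|\widetilde C_N^{(M)}-C_N^{(\infty)}\|_\infty\le\max_{i,\alpha}\bigl|c_{i,\alpha}-c_{i,\alpha}^{(M)}\bigr|+\max_{s,p}\bigl(1-r_{s,p}^{(M)}\bigr),$$ $$\|\Delta^{(M)}\|_{1\to1}=\|\widetilde C_N^{(M)}-C_N^{(\infty)}\|_1\le n\,\|\Delta^{(M)}\|_{\infty\to\infty},\qquad n=(N+1)r,$$ and consequently $$\bigl\|\widetilde\pi^{(N:M)}-\pi^{(N)}\bigr\|_1\le\|Z_N\|_{1\to1}\;n\Bigl(\max_{i,\alpha}\bigl|c_{i,\alpha}-c_{i,\alpha}^{(M)}\bigr|+\max_{s,p}\bigl(1-r_{s,p}^{(M)}\bigr)\Bigr).$$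 Here the maxima are over $0\le i\le N$, $1\le\alpha\le r$ and over $s\ge0$, $1\le p\le r$.
   Context: Fix an integer $r\ge1$. The state space is $S=\bigcup_{i\ge0}L_i$ with levels $L_i=\{(i,\alpha):\alpha=1,\dots,r\}$; $L_{\le N}=\bigcup_{i=0}^N L_i$, $L_{\le N}^c=S\setminus L_{\le N}$. A transition (stochastic) matrix $P=(P_{i,j})_{i,j\ge0}$ with $r\times r$ blocks is of $M/G/1$ type if $P_{0,j}=B_j$ for $j\ge0$, $P_{i,j}=A_{j-i}$ for $i\ge1$, $j\ge i-1$, and $P_{i,j}=0$ otherwise, with nonnegative $r\times r$ matrices $B_k$ ($k\ge0$), $A_k$ ($k\ge-1$); set $A_k=0$ for $k<-1$. Partition $P=\begin{pmatrix}T_N&U\\ D&Q\end{pmatrix}$ according to $L_{\le N}$ and $L_{\le N}^c$, complement levels $N+1,N+2,\dots$ being renumbered $0,1,\dots$: $Q_{i,t}=A_{t-i}$; $U_{0,s}=B_{N+1+s}$, $U_{i,s}=A_{N+1+s-i}$ ($1\le i\le N$); $D$ has the single nonzero block $D_{0,N}=A_{-1}$. Put $\hat Q=\sum_{m\ge0}Q^m$, $\hat Q^{(M)}=\sum_{m=0}^MQ^m$. The censored matrix on $L_{\le N}$ is $P^{(N)}=T_N+U\hat QD$. For a block matrix $X$, $X_{:,N}$ is its block-column with index $N$. Set $$C_N^{(M)}=[U\hat Q^{(M)}D]_{:,N},\qquad C_N^{(\infty)}=[U\hat QD]_{:,N},$$ $$c_{i,\alpha}=1-\sum_{j=0}^N\sum_{\beta=1}^r[T_{N,i,j}]_{\alpha\beta},\qquad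 c_{i,\alpha}^{(M)}=\sum_{\beta=1}^r[C_N^{(M)}]_{(i,\alpha),\beta},\qquad r_{s,p}^{(M)}=\sum_{d=1}^r\bigl[(\hat Q^{(M)}D)_{s,N}\bigr]_{p,d}.$$ RA-CM: define $\widetilde C_N^{(M)}$ row by row: its $(i,\alpha)$ row is $\frac{c_{i,\alpha}}{c_{i,\alpha}^{(M)}}[C_N^{(M)}]_{(i,\alpha),:}$ if $c_{i,\alpha}^{(M)}>0$; it is $c_{i,\alpha}(1/r,\dots,1/r)$ if $c_{i,\alpha}^{(M)}=0$ and $c_{i,\alpha}>0$; and it is $0$ if $c_{i,\alpha}=0$. Then $\widetilde P^{(N;M)}=T_N+(0,\dots,0,\widetilde C_N^{(M)})$ (added to the last block-column), a stochastic matrix on $L_{\le N}$. Conventions: probability vectors are row vectors; $\mathbf 1$ is the all-ones column vector. $\|A\|_{1\to1}$ (also written $\|\cdot\|_1$ for the matrix $\widetilde C_N^{(M)}-C_N^{(\infty)}$) is the operator norm of $x\mapsto xA$ on row vectors with the $\ell_1$ norm; $\|A\|_{\infty\to\infty}$ (also written $\|\cdot\|_\infty$ for $\widetilde C_N^{(M)}-C_N^{(\infty)}$) is the operator norm of $v\mapsto Av$ on column vectors with the sup norm, i.e. the maximal absolute row sum. *)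

(* Defs.v *)
From mathcomp Require Import all_boot all_order all_algebra.
From mathcomp Require Import all_classical all_reals all_analysis.
Set Implicit Arguments.
Unset Strict Implicit.
Unset Printing Implicit Defensive.
Import Order.TTheory GRing.Theory Num.Theory.
Local Open Scope classical_set_scope.
Local Open Scope ring_scope.

(** * Nonnegative matrices indexed by arbitrary (countable) sets

    Entries are extended reals, so that the sums of nonnegative terms below
    always exist. *)

Section Kernels.
Local Open Scope ereal_scope.
Context {R : realType}.

Definition ker_mul {I J K : choiceType} (X : I -> J -> \bar R)
    (Y : J -> K -> \bar R) (x : I) (z : K) : \bar R :=
  \esum_(y in [set: J]) (X x y * Y y z).

Definition ker_id {I : choiceType} (x y : I) : \bar R := ((x == y)%:R)%:E.

Fixpoint ker_pow {I : choiceType} (X : I -> I -> \bar R) (m : nat) :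
    I -> I -> \bar R :=
  if m is m'.+1 then ker_mul X (ker_pow X m') else ker_id.

Definition ker_stochastic {I : choiceType} (X : I -> I -> \bar R) : Prop :=
  (forall x y, 0 <= X x y) /\ (forall x, \esum_(y in [set: I]) X x y = 1).

Definition ker_irreducible {I : choiceType} (X : I -> I -> \bar R) : Prop :=
  forall x y, exists m : nat, 0 < ker_pow X m x y.

(* [first_passage X n x y] is the probability that the chain started at [x]
   visits [y] at time [n.+1] and at no time in [1, n]. *)
Fixpoint first_passage {I : choiceType} (X : I -> I -> \bar R) (n : nat)
    (x y : I) : \bar R :=
  if n is n'.+1
  then \esum_(z in [set z | z <> y]) (X x z * first_passage X n' z y)
  else X x y.

(* Each state is revisited almost surely, with finite mean return time. *)
Definition ker_positive_recurrent {I : choiceType} (X : I -> I -> \bar R) :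
    Prop :=
  forall x, \sum_(0 <= n <oo) first_passage X n x x = 1 /\
            \sum_(0 <= n <oo) (n.+1%:R%:E * first_passage X n x x) < +oo.

Definition ker_stationary {I : choiceType} (X : I -> I -> \bar R)
    (pi : I -> R) : Prop :=
  [/\ forall x, (0 <= pi x)%R,
      \esum_(x in [set: I]) (pi x)%:E = 1
    & forall y, \esum_(x in [set: I]) ((pi x)%:E * X x y) = (pi y)%:E].

End Kernels.

(** * Finite matrices *)

Section FiniteMatrices.
Context {R : realType}.

Definition mx_irreducible n (X : 'M[R]_n) : Prop :=
  forall i j, exists m : nat, 0 < (X ^+ m) i j.

Definition mx_stationary n (X : 'M[R]_n) (pi : 'rV[R]_n) : Prop :=
  [/\ forall j, 0 <= pi 0 j, \sum_j pi 0 j = 1 & pi *m X = pi].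

Definition norm1 n (x : 'rV[R]_n) : R := \sum_j `|x 0 j|.

Definition norm_sup n (v : 'cV[R]_n) : R := \big[Num.max/0]_i `|v i 0|.

(* Operator norm of [x |-> x A] on row vectors with the l1 norm. *)
Definition opnorm1 m n (A : 'M[R]_(m, n)) : R :=
  sup [set norm1 (x *m A) | x in [set x : 'rV[R]_m | norm1 x <= 1]].

(* Operator norm of [v |-> A v] on column vectors with the sup norm. *)
Definition opnorm_sup m n (A : 'M[R]_(m, n)) : R :=
  sup [set norm_sup (A *m v) | v in [set v : 'cV[R]_n | norm_sup v <= 1]].

End FiniteMatrices.

(** * Matrices of M/G/1 type and their censoring on the levels 0, ..., N

    Phases are numbered from 0 to r - 1. *)

Notation state r := (nat * 'I_r)%type.
Notation lowstate N r := ('I_N.+1 * 'I_r)%type.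
Notation lowdim N r := (\sum_(i < N.+1) r)%N.

Section Censoring.
Context {R : realType} {r : nat}.

Definition block_ker (P : nat -> nat -> 'M[R]_r) (x y : state r) : \bar R :=
  (P x.1 y.1 x.2 y.2)%:E.

Definition mg1_type (P : nat -> nat -> 'M[R]_r) : Prop :=
  exists (B : nat -> 'M[R]_r) (A : int -> 'M[R]_r),
    [/\ forall k a b, 0 <= B k a b,
        forall k a b, 0 <= A k a b
      & forall i j, P i j =
          if i == 0%N then B j
          else if (i <= j.+1)%N then A (j%:Z - i%:Z) else 0].

Context (P : nat -> nat -> 'M[R]_r) (N : nat).

(* The four parts of [P]; level [s] of the complement is level [N + 1 + s]. *)
Definition partT : 'M[R]_(lowdim N r) := \mxblock_(i < N.+1, j < N.+1) P i j.
Definition partU (x : lowstate N r) (y : state r) : \bar R :=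
  (P x.1 (N.+1 + y.1)%N x.2 y.2)%:E.
Definition partD (x : state r) (y : lowstate N r) : \bar R :=
  (P (N.+1 + x.1)%N y.1 x.2 y.2)%:E.
Definition partQ (x y : state r) : \bar R :=
  (P (N.+1 + x.1)%N (N.+1 + y.1)%N x.2 y.2)%:E.

Definition Qhat (x y : state r) : \bar R :=
  (\sum_(0 <= m <oo) ker_pow partQ m x y)%E.
Definition QhatM (M : nat) (x y : state r) : \bar R :=
  (\sum_(0 <= m < M.+1) ker_pow partQ m x y)%E.

Definition UQD : lowstate N r -> lowstate N r -> \bar R :=
  ker_mul partU (ker_mul Qhat partD).
Definition UQDM (M : nat) : lowstate N r -> lowstate N r -> \bar R :=
  ker_mul partU (ker_mul (QhatM M) partD).

(* The entries of [X] are finite in all the uses below. *)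
Definition low_block (X : lowstate N r -> lowstate N r -> \bar R)
    (i j : 'I_N.+1) : 'M[R]_r :=
  \matrix_(a, b) fine (X (i, a) (j, b)).

Definition censored : 'M[R]_(lowdim N r) :=
  partT + \mxblock_(i < N.+1, j < N.+1) low_block UQD i j.

Definition Cinf : 'M[R]_(lowdim N r, r) :=
  \mxcol_(i < N.+1) low_block UQD i ord_max.
Definition CM (M : nat) : 'M[R]_(lowdim N r, r) :=
  \mxcol_(i < N.+1) low_block (UQDM M) i ord_max.

Definition cdef (x : lowstate N r) : R :=
  1 - \sum_(j < N.+1) \sum_(b < r) P x.1 j x.2 b.
Definition cM (M : nat) (x : lowstate N r) : R :=
  \sum_(b < r) low_block (UQDM M) x.1 ord_max x.2 b.
Definition rM (M : nat) (x : state r) : R :=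
  \sum_(d < r) fine (ker_mul (QhatM M) partD x (ord_max, d)).

Definition CtildeM (M : nat) : 'M[R]_(lowdim N r, r) :=
  \mxcol_(i < N.+1) \matrix_(a < r, b < r)
    if 0 < cM M (i, a)
    then cdef (i, a) / cM M (i, a) * low_block (UQDM M) i ord_max a b
    else if 0 < cdef (i, a) then cdef (i, a) / r%:R else 0.

(* The matrix (0, ..., 0, C). *)
Definition last_col (C : 'M[R]_(lowdim N r, r)) : 'M[R]_(lowdim N r) :=
  \mxrow_(j < N.+1) (if j == ord_max then C else 0).

Definition racm (M : nat) : 'M[R]_(lowdim N r) := partT + last_col (CtildeM M).

Definition Delta (M : nat) : 'M[R]_(lowdim N r) := racm M - censored.

Definition fundamental (piN : 'rV[R]_(lowdim N r)) : 'M[R]_(lowdim N r) :=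
  1%:M - censored + const_mx 1 *m piN.

Definition max_cdiff (M : nat) : R :=
  \big[Num.max/0]_(x : lowstate N r) `|cdef x - cM M x|.
(* Since [rM M (s, p) = 0] for [s > M], this supremum is a maximum. *)
Definition max_rdef (M : nat) : R :=
  sup [set 1 - rM M x | x in [set: state r]].

End Censoring.

(* Main.v *)
Require Import Defs.
From mathcomp Require Import all_boot all_order all_algebra.
From mathcomp Require Import all_classical all_reals all_analysis.
Import Order.TTheory GRing.Theory Num.Theory.
Import numFieldNormedType.Exports.
Set Implicit Arguments.
Unset Strict Implicit.
Unset Printing Implicit Defensive.
Local Open Scope classical_set_scope.
Local Open Scope ring_scope.

(** Both the censored matrix and its approximation have the form [T + C], where
    the correction [C] describes the excursions above level [N] and lives in the
    last block-column, since the chain descends one level at a time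
    ([skip_free]).

    The analytic input is that the chain comes back from above level [N] almost
    surely ([hit_eq1]). The probability of hitting the levels up to [N] is
    bounded and superharmonic; tested against the stationary distribution, which
    is positive everywhere by irreducibility, it must be harmonic, and being
    equal to 1 somewhere it is equal to 1 everywhere ([superharmonic_eq1]). Hence
    the rows of the full correction have exactly the mass [cdef] missing from
    [T], so the censored matrix is stochastic. Its irreducibility is inherited
    from [P] by deleting from a path its stretches above level [N]
    ([irreducible_completion]).

    The truncated correction consists of the first terms of the series of
    excursions ([UQDME], [UQDE]), so it increases entrywise to the full one.
    Therefore its support is the full support for [M] large, which gives the
    irreducibility of the approximations, and its row masses [cM] tend to
    [cdef]. In a row, truncation removes the mass [cdef - cM] and
    renormalization puts the same mass back, so that a row of [Delta] has
    absolute sum at most [2 (cdef - cM)] ([Delta_rowsum]); this tends to 0. For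
    the explicit bound, [cdef - cM] is the probability of an excursion with
    more than [M] steps, hence at most [max_rdef] ([cdef_le_cM_rdef]).

    The rest is finite-dimensional: an irreducible stochastic matrix has one
    stationary vector and an invertible fundamental matrix [Z], the identity
    [q - p = q Delta Z] bounds the difference of two stationary vectors
    ([stationary_perturbation]), and both operator norms are equal to the
    maximal absolute row sum ([opnorm1E], [opnorm_supE]), so that the factor
    [n] is harmless. *)

(** * Operator norms of finite matrices *)

Section OperatorNorms.
Context {R : realType}.

(** Both operator norms of the statement are the maximal absolute row sum: the
    one acts on row vectors from the left, the other on column vectors. *)
Definition maxrowsum m n (A : 'M[R]_(m, n)) : R :=
  \big[Num.max/0]_i \sum_j `|A i j|.

Lemma le_bigmaxr (I : finType) (F : I -> R) i :
  F i <= \big[Num.max/0]_j F j.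
Proof. exact: le_bigmax_cond. Qed.

Lemma bigmaxr_le (I : finType) (F : I -> R) x :
  0 <= x -> (forall i, F i <= x) -> \big[Num.max/0]_j F j <= x.
Proof. by move=> x0 Fx; apply/bigmax_leP; split=> // i _; exact: Fx. Qed.

Lemma bigmaxr_ge0 (I : finType) (F : I -> R) : 0 <= \big[Num.max/0]_j F j.
Proof. exact: bigmax_ge_id. Qed.

Lemma bigmaxr_attained (I : finType) (F : I -> R) :
  (exists i, \big[Num.max/0]_j F j = F i) \/ \big[Num.max/0]_j F j = 0.
Proof.
apply: (big_ind (fun x => (exists i, x = F i) \/ x = 0)).
- by right.
- move=> x y hx hy; case: (leP x y) => _; [exact: hy|exact: hx].
- by move=> i _; left; exists i.
Qed.

Lemma norm1_ge0 n (x : 'rV[R]_n) : 0 <= norm1 x.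
Proof. exact: sumr_ge0. Qed.

Lemma maxrowsum_ge0 m n (A : 'M[R]_(m, n)) : 0 <= maxrowsum A.
Proof. exact: bigmaxr_ge0. Qed.

Lemma norm1_mulmx_le m n (A : 'M[R]_(m, n)) (x : 'rV[R]_m) :
  norm1 (x *m A) <= norm1 x * maxrowsum A.
Proof.
rewrite /norm1 mulr_suml.
apply: (@le_trans _ _ (\sum_i \sum_j `|x 0 i| * `|A i j|)).
  rewrite exchange_big ler_sum//= => j _; rewrite mxE.
  apply: le_trans (ler_norm_sum _ _ _) _.
  by apply: ler_sum => i _; rewrite normrM.
by apply: ler_sum => i _; rewrite -mulr_sumr ler_wpM2l// le_bigmaxr.
Qed.

Lemma norm_sup_mulmx_le m n (A : 'M[R]_(m, n)) (v : 'cV[R]_n) :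
  norm_sup (A *m v) <= maxrowsum A * norm_sup v.
Proof.
apply: bigmaxr_le => [|i]; first by rewrite mulr_ge0// bigmaxr_ge0.
rewrite mxE; apply: le_trans (ler_norm_sum _ _ _) _.
apply: (@le_trans _ _ ((\sum_j `|A i j|) * norm_sup v)).
  rewrite mulr_suml ler_sum// => j _; rewrite normrM ler_wpM2l//.
  exact: le_bigmaxr.
by rewrite ler_wpM2r ?bigmaxr_ge0// le_bigmaxr.
Qed.

Lemma sup_attained (E : set R) x : E x -> (forall y, E y -> y <= x) -> sup E = x.
Proof.
move=> Ex ubx; apply/eqP; rewrite eq_le; apply/andP; split.
  by apply: ge_sup; [exists x|].
by apply: ub_le_sup => //; exists x.
Qed.

(** The bound is attained at the unit row vector of a maximal row. *)
Lemma opnorm1E m n (A : 'M[R]_(m, n)) : opnorm1 A = maxrowsum A.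
Proof.
apply: sup_attained => [|_ [x x1 <-]]; last first.
  apply: le_trans (norm1_mulmx_le _ _) _.
  by rewrite ler_piMl// maxrowsum_ge0.
rewrite /maxrowsum; case: (bigmaxr_attained (fun i => \sum_j `|A i j|)).
  move=> [i ->]; exists (delta_mx 0 i) => /=.
    rewrite /norm1 (bigD1 i)//= big1 => [|j ji]; rewrite !mxE !eqxx.
      by rewrite normr1 addr0.
    by rewrite (negPf ji) normr0.
  by rewrite -rowE /norm1; apply: eq_bigr => j _; rewrite mxE.
move=> ->; exists 0 => /=; rewrite ?mul0mx /norm1 big1 ?ler01// => j _;
  by rewrite mxE normr0.
Qed.

(** The bound is attained at the vector of signs of a maximal row. *)
Lemma opnorm_supE m n (A : 'M[R]_(m, n)) : opnorm_sup A = maxrowsum A.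
Proof.
apply: sup_attained => [|_ [v v1 <-]]; last first.
  apply: le_trans (norm_sup_mulmx_le _ _) _.
  by rewrite ler_piMr// maxrowsum_ge0.
pose F i := \sum_j `|A i j|.
have [[i Fi]|F0] := bigmaxr_attained F; last first.
  exists 0 => /=.
    by apply: bigmaxr_le; rewrite ?ler01// => i; rewrite mxE normr0 ler01.
  apply/eqP; rewrite eq_le [maxrowsum A]F0 bigmaxr_ge0 andbT.
  by apply: bigmaxr_le => // i; rewrite mulmx0 mxE normr0.
pose v : 'cV[R]_n := \col_j Num.sg (A i j).
have v1 : norm_sup v <= 1.
  apply: bigmaxr_le; rewrite ?ler01// => j; rewrite mxE normr_sg.
  by case: (_ != _); rewrite ?ler01.
exists v => //; apply/eqP; rewrite eq_le; apply/andP; split.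
  apply: le_trans (norm_sup_mulmx_le _ _) _.
  by rewrite ler_piMr// maxrowsum_ge0.
rewrite [maxrowsum A]Fi; apply: le_trans (le_bigmaxr _ i).
rewrite mxE; apply: le_trans (ler_norm _); apply: ler_sum => j _.
by rewrite mxE mulrC -normrEsg.
Qed.

Lemma norm1_mulmx m n (A : 'M[R]_(m, n)) (x : 'rV[R]_m) :
  norm1 (x *m A) <= norm1 x * opnorm1 A.
Proof. by rewrite opnorm1E norm1_mulmx_le. Qed.

End OperatorNorms.

(** * Stationary vectors of finite stochastic matrices *)

Lemma expmx_ge0 {R : realType} n (X : 'M[R]_n) m i j :
  (forall i j, 0 <= X i j) -> 0 <= (X ^+ m) i j.
Proof.
move=> X0; elim: m i j => [|m IH] i j; first by rewrite expr0 mxE; case: eqP.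
by rewrite exprS mxE sumr_ge0// => k _; rewrite mulr_ge0.
Qed.

Section StochasticMatrices.
Context {R : realType}.

Definition mx_stochastic n (X : 'M[R]_n) : Prop :=
  (forall i j, 0 <= X i j) /\ (forall i, \sum_j X i j = 1).

Variables (n : nat) (X : 'M[R]_n).
Hypothesis X_stoch : mx_stochastic X.

Lemma stoch_sum_mulmx (v : 'rV[R]_n) : \sum_j (v *m X) 0 j = \sum_j v 0 j.
Proof.
under eq_bigr do rewrite mxE.
rewrite exchange_big; apply: eq_bigr => i _ /=.
by rewrite -mulr_sumr X_stoch.2 mulr1.
Qed.

(** A stochastic matrix preserves total mass, so no coordinate can gain. This
    turns the inequalities satisfied by the absolute value and by the positive
    part of an invariant vector into equalities. *)
Lemma subinvariant_invariant (v : 'rV[R]_n) :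
  (forall j, v 0 j <= (v *m X) 0 j) -> v *m X = v.
Proof.
move=> vX; apply/rowP => j; apply/eqP; rewrite -subr_eq0; apply/eqP.
have d0 k : predT k -> 0 <= (v *m X) 0 k - v 0 k by rewrite subr_ge0.
apply: (psumr_eq0P d0 _ (i := j)) => //.
by rewrite sumrB stoch_sum_mulmx subrr.
Qed.

Lemma abs_invariant (v : 'rV[R]_n) :
  v *m X = v -> map_mx Num.norm v *m X = map_mx Num.norm v.
Proof.
move=> vX; apply: subinvariant_invariant => j.
rewrite mxE -{1}vX mxE [leRHS]mxE; apply: le_trans (ler_norm_sum _ _ _) _.
apply: ler_sum => i _.
by rewrite normrM mxE (ger0_norm (X_stoch.1 _ _)).
Qed.

Lemma pos_invariant (v : 'rV[R]_n) (p := map_mx (Num.max 0) v) :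
  v *m X = v -> p *m X = p.
Proof.
move=> vX; apply: subinvariant_invariant => j.
rewrite mxE ge_max; apply/andP; split.
  rewrite mxE sumr_ge0// => i _.
  by rewrite mxE mulr_ge0 ?X_stoch.1// le_max lexx.
rewrite -{1}vX !mxE ler_sum// => i _.
by rewrite mxE ler_wpM2r ?X_stoch.1// le_max lexx orbT.
Qed.

(** As [X] fixes the all-ones column, [X - 1] is singular and has a left null
    vector; its normalized absolute value is stationary. *)
Lemma mx_stationary_exists : (0 < n)%N -> exists v, mx_stationary X v.
Proof.
move=> n0; have [v v0 vX] : exists2 v : 'rV[R]_n, v != 0 & v *m X = v.
  have : ~~ row_free (X - 1%:M).
    apply/negP => /row_freeP[Y XY].
    have : (X - 1%:M) *m const_mx (m:= n) (n:=1) 1 = 0.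
      apply/colP => i; rewrite mulmxBl mul1mx !mxE.
      under eq_bigr do rewrite mxE mulr1.
      by rewrite X_stoch.2 subrr.
    move=> X0; have XU : X - 1%:M \in unitmx.
      by rewrite -row_free_unit; apply/row_freeP; exists Y.
    have := congr1 (mulmx (invmx (X - 1%:M))) X0.
    rewrite mulKmx// mulmx0 => /colP/(_ (Ordinal n0)).
    by rewrite !mxE => /eqP; rewrite oner_eq0.
  rewrite -kermx_eq0 => /rowV0Pn[v /sub_kermxP vX v0]; exists v => //.
  by apply/eqP; rewrite -subr_eq0 -{2}[v]mulmx1 -mulmxBr vX.
have s0 : 0 < norm1 v.
  rewrite lt_def norm1_ge0 andbT; apply: contra_neq v0 => /psumr_eq0P s0.
  apply/rowP => j; rewrite mxE; apply/eqP.
  by rewrite -normr_eq0 s0.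
exists ((norm1 v)^-1 *: map_mx Num.norm v); split.
- by move=> j; rewrite !mxE mulr_ge0// invr_ge0 ltW.
- under eq_bigr do rewrite !mxE.
  by rewrite -mulr_sumr mulVf// gt_eqF.
- by rewrite -scalemxAl abs_invariant.
Qed.

Hypothesis X_irr : mx_irreducible X.

Lemma invariant_expmx (v : 'rV[R]_n) m : v *m X = v -> v *m (X ^+ m) = v.
Proof.
move=> vX; elim: m => [|m IH]; first by rewrite expr0 mulmx1.
by rewrite exprS mulmxA vX.
Qed.

Lemma invariant_pos (p : 'rV[R]_n) i j :
  p *m X = p -> (forall k, 0 <= p 0 k) -> 0 < p 0 i -> 0 < p 0 j.
Proof.
move=> pX p0 pi; have [m Xm] := X_irr i j.
rewrite -(invariant_expmx m pX) mxE (bigD1 i)//= ltr_pwDl// ?mulr_gt0//.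
by rewrite sumr_ge0// => k _; rewrite mulr_ge0// expmx_ge0//; exact: X_stoch.1.
Qed.

(** By irreducibility the positive part of an invariant vector vanishes or is
    positive everywhere; the latter contradicts total mass zero. The same
    applies to the opposite vector. *)
Lemma invariant_sum0 (v : 'rV[R]_n) : v *m X = v -> \sum_j v 0 j = 0 -> v = 0.
Proof.
have key (w : 'rV[R]_n) : w *m X = w -> \sum_j w 0 j = 0 -> forall i, w 0 i <= 0.
  move=> wX w0 i; rewrite leNgt; apply/negP => wi.
  have pw j : 0 < w 0 j.
    have := invariant_pos (i := i) j (pos_invariant wX).
    rewrite !mxE !lt_max !ltxx/=; apply=> // k.
    by rewrite mxE le_max lexx.
  have /eqP := w0; rewrite gt_eqF// (bigD1 i)//= ltr_pwDl//.
  by rewrite sumr_ge0// => k _; rewrite ltW.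
move=> vX v0; apply/rowP => i; apply/eqP; rewrite mxE eq_le key//=.
rewrite -oppr_le0; have := key (- v); rewrite mulNmx vX => /(_ erefl).
under eq_bigr do rewrite mxE; rewrite sumrN v0 oppr0 => /(_ erefl i).
by rewrite mxE.
Qed.

Lemma mx_stationary_uniq u v : mx_stationary X u -> mx_stationary X v -> u = v.
Proof.
move=> [_ u1 uX] [_ v1 vX]; apply/eqP; rewrite -subr_eq0; apply/eqP.
apply: invariant_sum0; first by rewrite mulmxBl uX vX.
by under eq_bigr do rewrite 2!mxE; rewrite sumrB u1 v1 subrr.
Qed.

Lemma mx_stationary_exists_unique : (0 < n)%N -> exists! v, mx_stationary X v.
Proof.
move=> n0; have [v Xv] := mx_stationary_exists n0.
by exists v; split=> // u; exact: mx_stationary_uniq.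
Qed.

Lemma mul_const_mx1 (v : 'rV[R]_n) :
  v *m const_mx (m := n) (n := 1) 1 = (\sum_j v 0 j)%:M.
Proof.
apply/rowP => i; rewrite !mxE ord1 eqxx mulr1n.
by apply: eq_bigr => j _; rewrite mxE mulr1.
Qed.

(** A left null vector [v] of [1 - X + 1 p] has total mass zero, because
    [1 - X] annihilates the all-ones column; hence [v] is invariant, and zero
    by the previous lemmas. *)
Lemma fundamental_unitmx p : mx_stationary X p ->
  1%:M - X + const_mx 1 *m p \in unitmx.
Proof.
move=> [_ p1 pX]; rewrite -row_free_unit -kermx_eq0; apply/rowV0P.
move=> v /sub_kermxP; rewrite mulmxDr mulmxBr mulmx1 mulmxA mul_const_mx1.
rewrite mul_scalar_mx => v0.
have v1 : \sum_j v 0 j = 0.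
  apply: (addrI (\sum_j v 0 j)); rewrite addr0 -[RHS]stoch_sum_mulmx.
  rewrite -[v *m X]addr0 -v0 addrA [v *m X + _]addrC subrK.
  under [RHS]eq_bigr do rewrite 2!mxE.
  by rewrite big_split/= -mulr_sumr p1 mulr1.
apply: invariant_sum0 => //; move: v0; rewrite v1 scale0r addr0 => /eqP.
by rewrite subr_eq0 => /eqP.
Qed.

(** With [Z] the fundamental matrix, [q - p = q (Y - X) Z]: indeed
    [(q - p) (1 - X + 1 p) = q - q X = q (Y - X)]. *)
Lemma stationary_perturbation (Y : 'M[R]_n) p q :
  mx_stationary X p -> mx_stationary Y q ->
  norm1 (q - p) <=
    opnorm1 (Y - X) * opnorm1 (invmx (1%:M - X + const_mx 1 *m p)).
Proof.
move=> Xp [q0 q1 qY]; have FU := fundamental_unitmx Xp.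
have [_ p1 pX] := Xp.
have -> : q - p = q *m (Y - X) *m invmx (1%:M - X + const_mx 1 *m p).
  rewrite -[LHS](mulmxK FU); congr (_ *m _).
  rewrite mulmxDr mulmxBr mulmx1 mulmxA mul_const_mx1 !mulmxBl.
  under eq_bigr do rewrite 2!mxE; rewrite sumrB q1 p1 subrr mul_scalar_mx scale0r.
  by rewrite addr0 pX mulmxBr qY opprB addrA subrK.
apply: le_trans (norm1_mulmx _ _) _.
rewrite ler_wpM2r//; first by rewrite opnorm1E maxrowsum_ge0.
apply: le_trans (norm1_mulmx _ _) _.
rewrite /norm1; under eq_bigr do rewrite ger0_norm//.
by rewrite q1 mul1r.
Qed.

End StochasticMatrices.

(** * Sums of nonnegative families and kernels *)

Section SumsOfNonnegatives.
Local Open Scope ereal_scope.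
Context {R : realType}.

Lemma esum_finType (I : finType) (f : I -> \bar R) : (forall i, 0 <= f i) ->
  \esum_(i in [set: I]) f i = \sum_i f i.
Proof.
move=> f0; rewrite esum_fset//; last exact: finite_finset.
rewrite (fsbigE (index_enum I)) ?index_enum_uniq// => [|i _].
  by apply: eq_bigl => i; rewrite in_setT.
by rewrite mem_index_enum.
Qed.

Lemma esum_ge_term (I : choiceType) (A : set I) (f : I -> \bar R) i :
  (forall j, A j -> 0 <= f j) -> A i -> f i <= \esum_(j in A) f j.
Proof.
move=> f0 Ai; apply: esum_ge; exists [set i]; last by rewrite fsbig_set1.
by split=> // j ->.
Qed.

Lemma esum_gt0 (I : choiceType) (A : set I) (f : I -> \bar R) :
  (forall j, A j -> 0 <= f j) ->
  0 < \esum_(j in A) f j -> exists2 i, A i & 0 < f i.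
Proof.
move=> f0 s0; apply: contrapT => nf; move: s0; rewrite esum1 ?ltxx// => i Ai.
apply/eqP; rewrite eq_le f0// andbT leNgt; apply/negP => fi.
by apply: nf; exists i.
Qed.

Lemma esum_exchange (I J : choiceType) (A : set I) (B : set J)
    (a : I -> J -> \bar R) : (forall i j, 0 <= a i j) ->
  \esum_(i in A) \esum_(j in B) a i j = \esum_(j in B) \esum_(i in A) a i j.
Proof.
move=> a0; rewrite !esum_esum//.
rewrite (reindex_esum (B `*`` fun=> A) _ (fun x => (x.2, x.1)))//; split=> //=.
- by move=> [j i] [].
- by move=> [i1 j1] [i2 j2] /= _ _ [] -> ->.
- by move=> [i j] [Ai Bj]/=; exists (j, i).
Qed.

(** Two opposite estimates; the second one follows from the first with
    [c^-1] when [c] is finite and positive. *)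
Lemma esumZl (I : choiceType) (A : set I) (c : \bar R) (f : I -> \bar R) :
  0 <= c -> (forall i, 0 <= f i) ->
  \esum_(i in A) (c * f i) = c * \esum_(i in A) f i.
Proof.
have le k (g : I -> \bar R) : 0 <= k -> (forall i, 0 <= g i) ->
    \esum_(i in A) (k * g i) <= k * \esum_(i in A) g i.
  move=> k0 g0; apply: ge_ereal_sup => _ [X [finX XA] <-].
  rewrite -ge0_mule_fsumr//; apply: lee_wpmul2l => //.
  by apply: ereal_sup_ubound; exists X.
move=> c0 f0; apply/eqP; rewrite eq_le le//=.
case: c c0 => [c| |]// c0.
- have {c0} [<-|c0] : (0 = c \/ 0 < c)%R.
    by move: c0; rewrite lee_fin le_eqVlt => /orP[/eqP|]; [left|right].
    by rewrite mul0e esum_ge0// => i _; rewrite mul0e.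
  rewrite -lee_pdivlMl//.
  rewrite (eq_esum (b := fun i => (c^-1)%:E * (c%:E * f i))); last first.
    by move=> i _; rewrite muleA -EFinM mulVf ?mul1e// gt_eqF.
  apply: le => [|i]; first by rewrite lee_fin invr_ge0 ltW.
  by rewrite mule_ge0// lee_fin ltW.
- have [<-|f1] : 0 = \esum_(i in A) f i \/ 0 < \esum_(i in A) f i.
    have : 0 <= \esum_(i in A) f i by rewrite esum_ge0.
    by rewrite le_eqVlt => /orP[/eqP|]; [left|right].
    by rewrite mule0 esum_ge0// => i _; rewrite mule_ge0.
  have [i Ai fi] := esum_gt0 (fun i _ => f0 i) f1.
  rewrite [leLHS]gt0_mulye//.
  apply: (le_trans _ (esum_ge_term (i := i) _ Ai)) => [|j _].
    by rewrite gt0_mulye.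
  by rewrite mule_ge0.
Qed.

(** A strict inequality in one term would survive in the sums, as the other
    terms contribute a finite amount. *)
Lemma esum_le_eq (I : choiceType) (A : set I) (a b : I -> \bar R) :
  (forall i, A i -> 0 <= a i <= b i) -> \esum_(i in A) b i < +oo ->
  \esum_(i in A) b i <= \esum_(i in A) a i -> forall i, A i -> a i = b i.
Proof.
move=> ab boo ba i Ai.
have a0 j : A j -> 0 <= a j by move=> /ab/andP[].
have b0 j : A j -> 0 <= b j by move=> /ab/andP[+ +]; exact: le_trans.
have abi := ab i Ai; apply/eqP; rewrite eq_le (andP abi).2/= leNgt.
apply/negP => lt_ab; move: ba; rewrite leNgt => /negP; apply.
rewrite (esumID [set i] A a)// (esumID [set i] A b)//.
have -> : A `&` [set i] = [set i] by apply/seteqP; split=> [j []|j ->].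
rewrite !esum_set1 ?a0 ?b0//.
have : \esum_(j in A `&` ~` [set i]) b j < +oo.
  apply: le_lt_trans boo; rewrite [leRHS](esumID [set i])// leeDr//.
  by rewrite esum_ge0// => j [/b0].
have : \esum_(j in A `&` ~` [set i]) a j <= \esum_(j in A `&` ~` [set i]) b j.
  by apply: le_esum => j [/ab/andP[]].
have : 0 <= \esum_(j in A `&` ~` [set i]) a j by rewrite esum_ge0// => j [/a0].
set x := \esum_(j in _) a j; set y := \esum_(j in _) b j => x0 xy yoo.
apply: lte_leD => //; rewrite ge0_fin_numE//.
exact: le_lt_trans xy yoo.
Qed.

End SumsOfNonnegatives.

Section KernelAlgebra.
Local Open Scope ereal_scope.
Context {R : realType}.

Definition ker_app (I J : choiceType) (X : I -> J -> \bar R) (f : J -> \bar R)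
    (x : I) : \bar R := \esum_(y in [set: J]) (X x y * f y).

Lemma ker_app_ge0 (I J : choiceType) (X : I -> J -> \bar R) f x :
  (forall x y, 0 <= X x y) -> (forall y, 0 <= f y) -> 0 <= ker_app X f x.
Proof. by move=> X0 f0; rewrite esum_ge0// => y _; rewrite mule_ge0. Qed.

Lemma ker_mul_ge0 (I J K : choiceType) (X : I -> J -> \bar R)
    (Y : J -> K -> \bar R) x z :
  (forall x y, 0 <= X x y) -> (forall y z, 0 <= Y y z) -> 0 <= ker_mul X Y x z.
Proof. by move=> X0 Y0; rewrite esum_ge0// => y _; rewrite mule_ge0. Qed.

Lemma ker_pow_ge0 (I : choiceType) (X : I -> I -> \bar R) m x y :
  (forall x y, 0 <= X x y) -> 0 <= ker_pow X m x y.
Proof.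
move=> X0; elim: m x y => [|m IH] x y /=; last exact: ker_mul_ge0.
by rewrite /ker_id lee_fin.
Qed.

Lemma ker_app_mul (I J K : choiceType) (X : I -> J -> \bar R)
    (Y : J -> K -> \bar R) f x :
  (forall x y, 0 <= X x y) -> (forall y z, 0 <= Y y z) ->
  (forall z, 0 <= f z) ->
  ker_app (ker_mul X Y) f x = ker_app X (ker_app Y f) x.
Proof.
move=> X0 Y0 f0; rewrite /ker_app /ker_mul.
transitivity (\esum_(z in [set: K]) \esum_(y in [set: J])
                (X x y * Y y z * f z)).
  apply: eq_esum => z _; rewrite muleC -esumZl// => [|y]; last exact: mule_ge0.
  by apply: eq_esum => y _; rewrite muleC.
rewrite esum_exchange => [|z y]; last by rewrite !mule_ge0.
apply: eq_esum => y _; rewrite -esumZl// => [|z]; last exact: mule_ge0.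
by apply: eq_esum => z _; rewrite muleA.
Qed.

Lemma ker_app_pow0 (I : choiceType) (X : I -> I -> \bar R) f x :
  (forall x, 0 <= f x) -> ker_app (ker_pow X 0) f x = f x.
Proof.
move=> f0; rewrite /ker_app/= (esumID [set x])//; last first.
  by move=> y _; rewrite mule_ge0// lee_fin.
rewrite setTI esum_set1 ?mule_ge0// /ker_id ?lee_fin// eqxx mul1e esum1 ?adde0//.
move=> y [_ /eqP]; rewrite eq_sym => /negPf ->; exact: mul0e.
Qed.

Lemma ker_app_powS (I : choiceType) (X : I -> I -> \bar R) m f x :
  (forall x y, 0 <= X x y) -> (forall x, 0 <= f x) ->
  ker_app (ker_pow X m.+1) f x = ker_app X (ker_app (ker_pow X m) f) x.
Proof.
by move=> X0 f0; rewrite /= ker_app_mul// => y z; exact: ker_pow_ge0.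
Qed.

Lemma ker_appD (I J : choiceType) (X : I -> J -> \bar R) f g x :
  (forall x y, 0 <= X x y) -> (forall y, 0 <= f y) -> (forall y, 0 <= g y) ->
  ker_app X (fun y => f y + g y) x = ker_app X f x + ker_app X g x.
Proof.
move=> X0 f0 g0; rewrite /ker_app -esumD => [|y _|y _]; rewrite ?mule_ge0//.
by apply: eq_esum => y _; rewrite ge0_muleDr.
Qed.

Lemma le_ker_app (I J : choiceType) (X : I -> J -> \bar R) f g x :
  (forall x y, 0 <= X x y) -> (forall y, f y <= g y) ->
  ker_app X f x <= ker_app X g x.
Proof. by move=> X0 fg; apply: le_esum => y _; rewrite lee_wpmul2l. Qed.

Lemma eq_ker_app (I J : choiceType) (X : I -> J -> \bar R) f g x :
  f =1 g -> ker_app X f x = ker_app X g x.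
Proof. by move=> /funext ->. Qed.

End KernelAlgebra.

Section KernelPositivity.
Local Open Scope ereal_scope.
Context {R : realType} {I J K : choiceType}.
Variables (X : I -> J -> \bar R) (Y : J -> K -> \bar R).
Hypothesis X_ge0 : forall x y, 0 <= X x y.
Hypothesis Y_ge0 : forall y z, 0 <= Y y z.

Lemma ker_mul_gt0 x y z : 0 < X x y -> 0 < Y y z -> 0 < ker_mul X Y x z.
Proof.
move=> Xxy Yyz; apply: lt_le_trans (mule_gt0 Xxy Yyz) _.
by apply: (esum_ge_term (f := fun y => X x y * Y y z)) => // t _; exact: mule_ge0.
Qed.

Lemma ker_mul_gt0_ex x z :
  0 < ker_mul X Y x z -> exists y, 0 < X x y /\ 0 < Y y z.
Proof.
move=> /esum_gt0[y _|y _ XY]; first exact: mule_ge0.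
exists y; rewrite !lt_def X_ge0 Y_ge0 !andbT.
by split; apply: contraTneq XY => ->; rewrite ?mul0e ?mule0 ltxx.
Qed.

End KernelPositivity.

(** * Absorption probabilities and superharmonic functions *)

(** Here [Q] describes the moves inside a set [J] and [d] the probability of
    leaving it at the next step; the first exit from [J] takes place at time
    [m.+1] with probability [Q^m d]. *)
Section Absorption.
Local Open Scope ereal_scope.
Context {R : realType} {J : choiceType}.
Variables (Q : J -> J -> \bar R) (d : J -> \bar R).
Hypothesis Q_ge0 : forall x y, 0 <= Q x y.
Hypothesis d_ge0 : forall x, 0 <= d x.
Hypothesis Qd1 : forall x, ker_app Q (fun=> 1) x + d x = 1.

Definition absorbed_by M x := \sum_(0 <= m < M.+1) ker_app (ker_pow Q m) d x.
Definition absorbed x := \sum_(0 <= m <oo) ker_app (ker_pow Q m) d x.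

Let Qm_ge0 m x y : 0 <= ker_pow Q m x y. Proof. exact: ker_pow_ge0. Qed.
Let Qd_ge0 m x : 0 <= ker_app (ker_pow Q m) d x.
Proof. exact: ker_app_ge0. Qed.

Lemma absorbed_by_ge0 M x : 0 <= absorbed_by M x.
Proof. by rewrite sume_ge0. Qed.

Lemma absorbed_ge0 x : 0 <= absorbed x.
Proof. by rewrite nneseries_ge0. Qed.

Lemma ker_app_powSr m x : ker_app (ker_pow Q m.+1) (fun=> 1) x =
  ker_app (ker_pow Q m) (ker_app Q (fun=> 1)) x.
Proof.
have Q10 y : 0 <= ker_app Q (fun=> 1) y by rewrite ker_app_ge0.
elim: m x => [|m IH] x.
  by rewrite ker_app_powS// ker_app_pow0// (eq_ker_app _ _ (g := fun=> 1))// => y;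
    rewrite ker_app_pow0.
rewrite ker_app_powS// [RHS]ker_app_powS//; exact: eq_ker_app.
Qed.

(** The sum telescopes, since [Q^m d + Q^(m+1) 1 = Q^m (d + Q 1) = Q^m 1]. *)
Lemma absorbed_or_not M x :
  absorbed_by M x + ker_app (ker_pow Q M.+1) (fun=> 1) x = 1.
Proof.
have Q10 y : 0 <= ker_app Q (fun=> 1) y by rewrite ker_app_ge0.
have step m : ker_app (ker_pow Q m) d x +
    ker_app (ker_pow Q m.+1) (fun=> 1) x = ker_app (ker_pow Q m) (fun=> 1) x.
  rewrite ker_app_powSr -ker_appD//; apply: eq_ker_app => y.
  by rewrite addeC Qd1.
elim: M => [|M IH].
  by rewrite /absorbed_by big_nat1 step ker_app_pow0.
by rewrite /absorbed_by big_nat_recr// -addeA step -/(absorbed_by M x) IH.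
Qed.

Lemma absorbed_by_le1 M x : absorbed_by M x <= 1.
Proof. by rewrite -(absorbed_or_not M x) leeDl// ker_app_ge0. Qed.

Lemma absorbed_le1 x : absorbed x <= 1.
Proof.
apply: lime_le; first exact: is_cvg_nneseries.
apply: nearW => -[|M]; first by rewrite big_nil.
exact: absorbed_by_le1.
Qed.

(** First step analysis. *)
Lemma absorbedE x : absorbed x = d x + ker_app Q absorbed x.
Proof.
rewrite /absorbed nneseries_recl// ker_app_pow0//; congr (_ + _).
rewrite -nneseries_addn// nneseries_esumT//.
transitivity (\esum_(m in [set: nat]) ker_app Q (ker_app (ker_pow Q m) d) x).
  by apply: eq_esum => m _; rewrite addn1 ker_app_powS.
rewrite [LHS]esum_exchange; last first.
  by move=> m y; exact: mule_ge0 (Q_ge0 x y) (Qd_ge0 m y).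
by apply: eq_esum => y _; rewrite esumZl// nneseries_esumT.
Qed.

End Absorption.

Section RecurrentChain.
Local Open Scope ereal_scope.
Context {R : realType} {I : choiceType}.
Variables (X : I -> I -> \bar R) (pi : I -> R).
Hypothesis X_stoch : ker_stochastic X.
Hypothesis X_irr : ker_irreducible X.
Hypothesis pi_stat : ker_stationary X pi.

Let X_ge0 x y : 0 <= X x y. Proof. by case: X_stoch. Qed.
Let pi_ge0 x : 0 <= (pi x)%:E. Proof. by rewrite lee_fin; case: pi_stat. Qed.

Lemma ker_app_1 x : ker_app X (fun=> 1) x = 1.
Proof.
case: X_stoch => _ S1; rewrite -[RHS](S1 x).
by apply: eq_esum => y _; rewrite mule1.
Qed.

Lemma stationary_app f : (forall x, 0 <= f x) ->
  \esum_(x in [set: I]) ((pi x)%:E * ker_app X f x) =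
  \esum_(x in [set: I]) ((pi x)%:E * f x).
Proof.
move=> f0; have := @ker_app_mul R unit I I (fun _ x => (pi x)%:E) X f tt.
rewrite /ker_app => <-//; apply: eq_esum => x _.
by rewrite /ker_mul; case: pi_stat => _ _ ->.
Qed.

Lemma stationary_pow m y :
  \esum_(x in [set: I]) ((pi x)%:E * ker_pow X m x y) = (pi y)%:E.
Proof.
elim: m y => [|m IH] y.
  have := @ker_app_pow0 R I X (fun x => (pi x)%:E) y pi_ge0.
  rewrite /ker_app => <-; apply: eq_esum => x _ /=.
  by rewrite /ker_id eq_sym muleC.
rewrite -[RHS]IH; apply: (stationary_app (f := (ker_pow X m)^~ y)) => x.
exact: ker_pow_ge0.
Qed.

Lemma stationary_gt0 y : (0 < pi y)%R.
Proof.
have [x _ pix] : exists2 x, [set: I] x & 0 < (pi x)%:E.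
  by apply: esum_gt0 => //; case: pi_stat => _ -> _; rewrite lte01.
have [m Xm] := X_irr x y.
rewrite -lte_fin -(stationary_pow m); apply: lt_le_trans (mule_gt0 pix Xm) _.
apply: (esum_ge_term (f := fun x => (pi x)%:E * _)) => // z _.
by rewrite mule_ge0// ker_pow_ge0.
Qed.

(** The mean of [f - X f] under the stationary law is zero, so that [f] is
    harmonic, because the stationary law charges every state. Then
    [X^m f = f] for all [m], and the value 1 at [z], being an average of values
    at most 1, forces the value 1 wherever the chain can go from [z]. *)
Lemma superharmonic_eq1 f z :
  (forall x, 0 <= f x <= 1) -> (forall x, ker_app X f x <= f x) ->
  f z = 1 -> forall y, f y = 1.
Proof.
move=> f01 Xf fz1 y.
have f0 x : 0 <= f x by case/andP: (f01 x).
have f1 x : f x <= 1 by case/andP: (f01 x).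
have Xf0 x : 0 <= ker_app X f x by exact: ker_app_ge0.
have Xf_eq x : ker_app X f x = f x.
  have pif_oo : \esum_(x in [set: I]) ((pi x)%:E * f x) < +oo.
    apply: (@le_lt_trans _ _ 1); last exact: ltry.
    case: pi_stat => _ <- _; apply: le_esum => t _.
    by rewrite -[leRHS]mule1 lee_wpmul2l.
  have /(_ x Logic.I) : forall x, [set: I] x ->
      (pi x)%:E * ker_app X f x = (pi x)%:E * f x.
    apply: esum_le_eq => //; last by rewrite stationary_app.
    by move=> t _; rewrite mule_ge0//= lee_wpmul2l.
  have := stationary_gt0 x => pix /(congr1 (fun t => ((pi x)^-1)%:E * t)).
  by rewrite !muleA -EFinM mulVf ?mul1e// gt_eqF.
have Xmf m x : ker_app (ker_pow X m) f x = f x.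
  elim: m x => [|m IH] x; first by rewrite ker_app_pow0.
  by rewrite ker_app_powS// (eq_ker_app _ _ (g := f)).
have Xm1 m x : ker_app (ker_pow X m) (fun=> 1) x = 1.
  elim: m x => [|m IH] x; first by rewrite ker_app_pow0.
  by rewrite ker_app_powS// (eq_ker_app _ _ (g := fun=> 1))// ker_app_1.
have [m Xm] := X_irr z y.
have Xm0 x t : 0 <= ker_pow X m x t by exact: ker_pow_ge0.
have /(_ y Logic.I) : forall t, [set: I] t ->
    ker_pow X m z t * f t = ker_pow X m z t * 1.
  apply: esum_le_eq => [t _||].
  - by rewrite mule_ge0//= lee_wpmul2l.
  - by have := Xm1 m z; rewrite /ker_app => ->; exact: ltry.
  - by have := Xm1 m z; have := Xmf m z; rewrite /ker_app => -> ->; rewrite fz1.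
have : ker_pow X m z y <= 1.
  have := Xm1 m z; rewrite /ker_app => <-.
  apply: le_trans (esum_ge_term (i := y) _ _) => //; rewrite ?mule1// => t _.
  by rewrite mule1.
case: (ker_pow X m z y) Xm => [p| |]//; rewrite lte_fin => p0 _.
move=> /(congr1 (fun t => (p^-1)%:E * t)).
by rewrite !muleA -EFinM mulVf ?mul1e// gt_eqF.
Qed.

End RecurrentChain.

(** * Excursions above level N *)

(** [low] and [high] identify the two index types of the partition of the
    transition matrix with the two parts of the state space. *)
Section Levels.
Local Open Scope ereal_scope.
Context {R : realType} (N : nat) {r : nat}.

Definition low (x : lowstate N r) : state r := (nat_of_ord x.1, x.2).
Definition high (y : state r) : state r := ((N.+1 + y.1)%N, y.2).

Lemma low_or_high (z : state r) : (exists x, z = low x) \/ (exists y, z = high y).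
Proof.
case: z => k a; case: (ltnP k N.+1) => kN.
  by left; exists (Ordinal kN, a).
by right; exists ((k - N.+1)%N, a); rewrite /high/= subnKC.
Qed.

Lemma low_inj : injective low.
Proof. by move=> [i a] [j b] [/val_inj -> ->]. Qed.

Lemma high_inj : injective high.
Proof. by move=> [i a] [j b] [] /eqP; rewrite eqn_add2l => /eqP -> ->. Qed.

Lemma low_neq_high x y : low x <> high y.
Proof.
case: x y => [i a] [j b] [] e _; have := ltn_ord i.
by rewrite e addSn ltnS -ltn_subRL subnn.
Qed.

Lemma esum_levels (f : state r -> \bar R) : (forall z, 0 <= f z) ->
  \esum_(z in [set: state r]) f z =
  \sum_x f (low x) + \esum_(y in [set: state r]) f (high y).
Proof.
move=> f0; rewrite (esumID (range low))// setTI setTI.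
rewrite esum_image; last by move=> x y _ _; exact: low_inj.
have -> : ~` range low = range high.
  apply/seteqP; split=> [z nz|_ [y _ <-] [x _]]; last exact: low_neq_high.
  by have [[x zx]|[y ->]] := low_or_high z; [case: nz; exists x|exists y].
rewrite esum_image; last by move=> x y _ _; exact: high_inj.
by rewrite esum_finType.
Qed.

End Levels.

Section Censoring.
Local Open Scope ereal_scope.
Context {R : realType} {r : nat}.
Variables (P : nat -> nat -> 'M[R]_r) (N : nat).
Hypothesis P_stoch : ker_stochastic (block_ker P).

Notation U := (partU P (N := N)).
Notation D := (partD P (N := N)).
Notation Q := (partQ P N).

Lemma P_ge0 i j a b : (0 <= P i j a b)%R.
Proof. by rewrite -lee_fin; exact: P_stoch.1 (i, a) (j, b). Qed.

Lemma U_ge0 x y : 0 <= U x y. Proof. by rewrite lee_fin P_ge0. Qed.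
Lemma D_ge0 x y : 0 <= D x y. Proof. by rewrite lee_fin P_ge0. Qed.
Lemma Q_ge0 x y : 0 <= Q x y. Proof. by rewrite lee_fin P_ge0. Qed.
Lemma Qm_ge0 m x y : 0 <= ker_pow Q m x y.
Proof. exact: ker_pow_ge0 Q_ge0. Qed.
#[local] Hint Resolve U_ge0 D_ge0 Q_ge0 Qm_ge0 : core.

(** The probability of entering the lower levels at the next step. *)
Definition exit_prob : state r -> \bar R := ker_app D (fun=> 1).

Lemma exit_probE s : exit_prob s = \sum_w D s w.
Proof.
rewrite /exit_prob /ker_app esum_finType => [|w]; last by rewrite mule1.
by apply: eq_bigr => w _; rewrite mule1.
Qed.

Lemma exit_prob_ge0 s : 0 <= exit_prob s.
Proof. by rewrite /exit_prob ker_app_ge0. Qed.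
#[local] Hint Resolve exit_prob_ge0 : core.

Lemma app_high (f : state r -> \bar R) s : (forall z, 0 <= f z) ->
  ker_app (block_ker P) f (high N s) =
  \sum_w (D s w * f (low w)) + ker_app Q (f \o high N) s.
Proof.
move=> f0; rewrite /ker_app (esum_levels N)// => z.
by rewrite mule_ge0// lee_fin P_ge0.
Qed.

Lemma app_low (f : state r -> \bar R) (x : lowstate N r) : (forall z, 0 <= f z) ->
  ker_app (block_ker P) f (low x) =
  \sum_(w : lowstate N r) ((P x.1 w.1 x.2 w.2)%:E * f (low w)) + ker_app U (f \o high N) x.
Proof.
move=> f0; rewrite /ker_app (esum_levels N)// => z.
by rewrite mule_ge0// lee_fin P_ge0.
Qed.

Lemma stay_or_exit s : ker_app Q (fun=> 1) s + exit_prob s = 1.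
Proof.
rewrite -[RHS](ker_app_1 P_stoch (high N s)) [RHS]app_high//.
rewrite addeC exit_probE; congr (_ + _).
by apply: eq_bigr => w _; rewrite mule1.
Qed.

Definition hit_by M := absorbed_by Q exit_prob M.
Definition hit := absorbed Q exit_prob.

(** The probability of hitting the levels up to [N] at some time, time 0
    included, is 1 on these levels, is harmonic above them and is at most 1. It
    is thus superharmonic, with the value 1 at a lower state, and
    [superharmonic_eq1] makes it constant. *)
Lemma hit_eq1 (pi : state r -> R) :
  (0 < r)%N -> ker_irreducible (block_ker P) ->
  ker_stationary (block_ker P) pi -> forall s, hit s = 1.
Proof.
move=> r0 P_irr pi_stat s.
pose f (z : state r) := if (z.1 <= N)%N then 1 else hit (z.1 - N.+1, z.2)%N.
have f_low (x : lowstate N r) : f (low x) = 1 by rewrite /f ifT//; exact: ltn_ord x.1.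
have f_high y : f (high N y) = hit y.
  by rewrite /f/= addSn ltnNge leq_addr/= subSS addKn; case: y.
have f01 z : 0 <= f z <= 1.
  rewrite /f; case: ifP => _; first by rewrite lee01 lexx.
  by rewrite absorbed_ge0// absorbed_le1//; exact: stay_or_exit.
have f0 z : 0 <= f z by case/andP: (f01 z).
rewrite -f_high; apply: (superharmonic_eq1 P_stoch P_irr pi_stat f01) => [z|].
  have [[x ->]|[y ->]] := low_or_high N z.
    rewrite f_low -[leRHS](ker_app_1 P_stoch (low x)).
    apply: le_ker_app => [u v|u]; first by rewrite lee_fin P_ge0.
    by case/andP: (f01 u).
  rewrite app_high// f_high [leRHS]absorbedE// leeD//.
    rewrite exit_probE; apply: lee_sum => w _.
    by rewrite f_low mule1.
  by apply: le_ker_app => // u; rewrite /= f_high.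
exact: (f_low (ord0, Ordinal r0)).
Qed.

(** The [m]-th term of [U Qhat D], an excursion above the lower levels which
    makes [m] steps there. Truncating [Qhat] keeps the first terms. *)
Definition excursion m : lowstate N r -> lowstate N r -> \bar R :=
  ker_mul U (ker_mul (ker_pow Q m) D).

Lemma excursion_ge0 m x w : 0 <= excursion m x w.
Proof. by apply: ker_mul_ge0 => // y z; exact: ker_mul_ge0. Qed.
#[local] Hint Resolve excursion_ge0 : core.

Lemma QhatMD M s w :
  ker_mul (QhatM P N M) D s w = \sum_(0 <= m < M.+1) ker_mul (ker_pow Q m) D s w.
Proof.
rewrite /ker_mul -esum_sum => [|y m _ _]; last by rewrite mule_ge0.
by apply: eq_esum => y _; rewrite /QhatM ge0_sume_distrl.
Qed.

Lemma UQDME M x w : UQDM P M x w = \sum_(0 <= m < M.+1) excursion m x w.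
Proof.
rewrite /UQDM /excursion [ker_mul U]/ker_mul -esum_sum; last first.
  by move=> y m _ _; rewrite mule_ge0// ker_mul_ge0.
apply: eq_esum => y _; rewrite QhatMD ge0_sume_distrr// => m _.
exact: ker_mul_ge0.
Qed.

Lemma UQDE x w : UQD P x w = \sum_(0 <= m <oo) excursion m x w.
Proof.
have QD0 m s : 0 <= ker_mul (ker_pow Q m) D s w by exact: ker_mul_ge0.
have QhatD s : ker_mul (Qhat P N) D s w =
    \esum_(m in [set: nat]) ker_mul (ker_pow Q m) D s w.
  rewrite [RHS]esum_exchange => [|m y]; last by rewrite mule_ge0.
  apply: eq_esum => y _; rewrite /Qhat nneseries_esumT// muleC -esumZl//.
  by apply: eq_esum => m _; rewrite muleC.
rewrite nneseries_esumT// /UQD /excursion.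
rewrite [RHS]esum_exchange => [|m y]; last by rewrite mule_ge0.
by apply: eq_esum => y _; rewrite QhatD esumZl.
Qed.

Lemma excursion_row m x :
  \sum_w excursion m x w = ker_app U (ker_app (ker_pow Q m) exit_prob) x.
Proof.
have QD0 y z : 0 <= ker_mul (ker_pow Q m) D y z by exact: ker_mul_ge0.
rewrite -(esum_finType (f := excursion m x))//.
transitivity (ker_app (excursion m) (fun=> 1) x).
  by apply: eq_esum => w _; rewrite mule1.
rewrite ker_app_mul//; apply: eq_ker_app => y.
by rewrite ker_app_mul.
Qed.

Lemma UQDM_row M x : \sum_w UQDM P M x w = ker_app U (hit_by M) x.
Proof.
under eq_bigr do rewrite UQDME.
rewrite exchange_big/= [RHS]/ker_app.
transitivity (\sum_(0 <= m < M.+1) ker_app U (ker_app (ker_pow Q m) exit_prob) x).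
  by apply: eq_bigr => m _; exact: excursion_row.
rewrite /ker_app -esum_sum => [|y m _ _]; last first.
  by rewrite mule_ge0//; apply: esum_ge0 => z _; exact: mule_ge0.
apply: eq_esum => y _; rewrite /hit_by /absorbed_by ge0_sume_distrr// => m _.
by rewrite ker_app_ge0.
Qed.

Lemma UQD_row x : \sum_w UQD P x w = ker_app U hit x.
Proof.
have Q0 m y : 0 <= ker_app (ker_pow Q m) exit_prob y by exact: ker_app_ge0.
rewrite -(esum_finType (f := UQD P x)) => [|w]; last first.
  by rewrite UQDE nneseries_ge0.
transitivity (\esum_(w in [set: lowstate N r]) \esum_(m in [set: nat]) excursion m x w).
  by apply: eq_esum => w _; rewrite UQDE nneseries_esumT.
rewrite esum_exchange//.
transitivity (\esum_(m in [set: nat])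
    ker_app U (ker_app (ker_pow Q m) exit_prob) x).
  by apply: eq_esum => m _; rewrite -excursion_row esum_finType.
rewrite [LHS]esum_exchange => [|m y]; last by rewrite mule_ge0.
by apply: eq_esum => y _; rewrite esumZl// /hit /absorbed nneseries_esumT.
Qed.

(** The defect [cdef] of a row of [T] is the probability of going up. *)
Lemma U_row (x : lowstate N r) : ker_app U (fun=> 1) x = (cdef P x)%:E.
Proof.
have := @app_low (fun=> 1) x (fun=> lee01); rewrite (ker_app_1 P_stoch).
under eq_bigr do rewrite mule1.
rewrite sumEFin -(pair_bigA _ (fun (j : 'I_N.+1) (b : 'I_r) => P x.1 j x.2 b))/= => e.
apply/eqP; rewrite EFinB eq_sym sube_eq//; first by rewrite addeC -e.
by rewrite fin_num_adde_defl.
Qed.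

Section HitsSurely.
Hypothesis hit1 : forall s, hit s = 1.

Lemma UQD_ge0 (x w : lowstate N r) : 0 <= UQD P x w.
Proof. by rewrite UQDE nneseries_ge0. Qed.

Lemma UQDM_ge0 M (x w : lowstate N r) : 0 <= UQDM P M x w.
Proof. by rewrite UQDME sume_ge0. Qed.

Lemma UQDM_le M (x w : lowstate N r) : UQDM P M x w <= UQD P x w.
Proof. by rewrite UQDME UQDE; exact: nneseries_lim_ge. Qed.

(** Every excursion comes back, so that no mass is lost above. *)
Lemma sum_UQD (x : lowstate N r) : \sum_w UQD P x w = (cdef P x)%:E.
Proof. by rewrite UQD_row -U_row; apply: eq_ker_app. Qed.

Lemma UQD_fin (x w : lowstate N r) : UQD P x w \is a fin_num.
Proof.
rewrite ge0_fin_numE ?UQD_ge0//; apply: (@le_lt_trans _ _ (cdef P x)%:E).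
  rewrite -sum_UQD (bigD1 w)//= leeDl// sume_ge0// => v _; exact: UQD_ge0.
exact: ltry.
Qed.

Lemma UQDM_fin M (x w : lowstate N r) : UQDM P M x w \is a fin_num.
Proof.
rewrite ge0_fin_numE ?UQDM_ge0//; apply: le_lt_trans (UQDM_le M x w) _.
by rewrite -ge0_fin_numE ?UQD_fin ?UQD_ge0.
Qed.

Definition exact_corr (x w : lowstate N r) : R := fine (UQD P x w).
Definition approx_corr M (x w : lowstate N r) : R := fine (UQDM P M x w).

Lemma approx_corr_ge0 M (x w : lowstate N r) : (0 <= approx_corr M x w)%R.
Proof. by rewrite fine_ge0// UQDM_ge0. Qed.

Lemma approx_corr_le M (x w : lowstate N r) : (approx_corr M x w <= exact_corr x w)%R.
Proof. exact: fine_le (UQDM_fin M x w) (UQD_fin x w) (UQDM_le M x w). Qed.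

Lemma sum_exact_corr (x : lowstate N r) : (\sum_w exact_corr x w)%R = cdef P x.
Proof.
apply: EFin_inj; rewrite -sum_UQD -sumEFin; apply: eq_bigr => w _.
by rewrite fineK// UQD_fin.
Qed.

Lemma approx_corr_cvg (x w : lowstate N r) : approx_corr M x w @[M --> \oo] --> exact_corr x w.
Proof.
apply: fine_cvg; rewrite fineK ?UQD_fin// UQDE.
have : \sum_(0 <= m < M) excursion m x w @[M --> \oo] -->
    \sum_(0 <= m <oo) excursion m x w by exact: is_cvg_nneseries.
rewrite -(cvg_shiftS (fun M => \sum_(0 <= m < M) excursion m x w)).
apply: cvg_trans; apply: near_eq_cvg; near=> M; rewrite /= UQDME.
Unshelve. all: by end_near. Qed.

End HitsSurely.
End Censoring.

(** * Renormalized rows and level-indexed matrices *)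

Lemma big_last_level (V : Type) (idx : V) (op : Monoid.com_law idx)
    (N r : nat) (f : lowstate N r -> V) :
  (forall x, x.1 != ord_max -> f x = idx) ->
  \big[op/idx]_x f x = \big[op/idx]_b f (ord_max, b).
Proof.
move=> f0; transitivity (\big[op/idx]_i \big[op/idx]_b f (i, b)).
  by rewrite pair_bigA; apply: eq_bigr => -[].
rewrite (bigD1 ord_max)//= [X in op _ X]big1 ?Monoid.mulm1// => i iN.
by rewrite big1// => b _; rewrite f0.
Qed.

(** One row of the renormalized correction: [f] is the row of the truncated
    correction and [c] the mass it should carry. *)
Section Renormalization.
Context {R : realType}.
Variables (r : nat) (f : 'I_r -> R) (c : R).

Definition renormalized b : R :=
  if 0 < \sum_b f b then c / (\sum_b f b) * f b
  else if 0 < c then c / r%:R else 0.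

Hypothesis r_gt0 : (0 < r)%N.
Hypothesis f_ge0 : forall b, 0 <= f b.
Hypothesis f_le : \sum_b f b <= c.

Let s_ge0 : 0 <= \sum_b f b. Proof. exact: sumr_ge0. Qed.
Let c_ge0 : 0 <= c. Proof. exact: le_trans s_ge0 f_le. Qed.

Lemma renormalized_ge0 b : 0 <= renormalized b.
Proof.
rewrite /renormalized; case: ifPn => _; first by rewrite mulr_ge0 ?divr_ge0.
by case: ifPn => // _; rewrite divr_ge0.
Qed.

Lemma renormalized_gt0 b : 0 < f b -> 0 < renormalized b.
Proof.
move=> fb; have s0 : 0 < \sum_b f b.
  by rewrite (bigD1 b)//= ltr_pwDl// sumr_ge0.
by rewrite /renormalized s0 mulr_gt0// divr_gt0// (lt_le_trans s0).
Qed.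

Lemma sum_renormalized : \sum_b renormalized b = c.
Proof.
rewrite /renormalized; case: (boolP (0 < \sum_b f b)) => [s0|_].
  by rewrite -mulr_sumr divfK// gt_eqF.
case: (boolP (0 < c)) => [c0|]; last first.
  by rewrite -leNgt big1// => c0; apply/eqP; rewrite eq_le c0 c_ge0.
rewrite sumr_const card_ord -[LHS]mulr_natr divfK//.
by rewrite pnatr_eq0 -lt0n.
Qed.

(** The renormalization increases every entry, so that its l1 distance to [f]
    is the mass it adds. *)
Lemma renormalized_dist : \sum_b `|renormalized b - f b| = c - \sum_b f b.
Proof.
suff le_fg b : f b <= renormalized b.
  rewrite -[in RHS]sum_renormalized -sumrB; apply: eq_bigr => b _.
  by rewrite ger0_norm// subr_ge0.
rewrite /renormalized; case: ifPn => [s0|].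
  by rewrite ler_peMl// ler_pdivlMr// mul1r.
rewrite -leNgt => s0; have -> : f b = 0.
  by apply: (psumr_eq0P (P := predT)) => //; apply/eqP; rewrite eq_le s0 s_ge0.
by case: ifPn => // _; rewrite divr_ge0.
Qed.

End Renormalization.

Section LevelMatrices.
Context {R : realType} {N r : nat}.

(** The matrices of the statement are indexed by ordinals; [lowst] reads such an
    index as a level and a phase. *)
Definition lowst (s : 'I_(lowdim N r)) : lowstate N r :=
  (tagnat.sig1 s, tagnat.sig2 s).

Lemma lowst_bij : bijective lowst.
Proof.
exists (fun x => tagnat.Rank (p_ := fun=> r) x.1 x.2) => [s|x].
  exact: tagnat.sig2K.
by case: x => i a; rewrite /lowst /tagnat.sig1 /tagnat.sig2 tagnat.rankK.
Qed.

Lemma sum_lowst (V : nmodType) (F : lowstate N r -> V) :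
  \sum_s F (lowst s) = \sum_x F x.
Proof. by rewrite [RHS](reindex lowst)//; exact: onW_bij lowst_bij. Qed.

Lemma last_colE (X : 'M[R]_(lowdim N r, r)) s t :
  last_col X s t =
  if (lowst t).1 == ord_max then X s (lowst t).2 else 0.
Proof. by rewrite mxE /=; case: eqP => //; rewrite mxE. Qed.

Lemma maxrowsum_last_col (X : 'M[R]_(lowdim N r, r)) :
  maxrowsum (last_col X) = maxrowsum X.
Proof.
apply: eq_bigr => s _; under eq_bigr do rewrite last_colE.
rewrite (sum_lowst (fun w => `|if w.1 == ord_max then X s w.2 else 0|)).
rewrite big_last_level => [|x /negPf ->]; last by rewrite normr0.
by apply: eq_bigr => b _ /=; rewrite eqxx.
Qed.

Lemma last_colB (X Y : 'M[R]_(lowdim N r, r)) :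
  last_col (X - Y) = last_col X - last_col Y.
Proof.
apply/matrixP => s t; rewrite !mxE; case: eqP => _; rewrite !mxE//.
by rewrite subr0.
Qed.

End LevelMatrices.

(** * The censored matrix and its approximations *)

Section MG1Censoring.
Context {R : realType} {r : nat}.
Variables (P : nat -> nat -> 'M[R]_r) (N : nat).
Hypothesis r_gt0 : (0 < r)%N.
Hypothesis P_mg1 : mg1_type P.
Hypothesis P_stoch : ker_stochastic (block_ker P).

Hypothesis hit1 : forall s, hit P N s = 1%E.

(** The level decreases by at most one in a step: coming from above, the lower
    levels are entered at level [N]. *)
Lemma skip_free (s : state r) (w : lowstate N r) :
  w.1 != ord_max -> partD P s w = 0%E.
Proof.
move=> wN; rewrite /partD; have [B [A [_ _ ->]]] := P_mg1.
rewrite addSn/= ltnNge ifF ?mxE//; apply/negbTE; rewrite negbK.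
rewrite (leq_trans _ (leq_addr _ _))// ltn_neqAle -ltnS ltn_ord andbT.
by apply: contraNneq wN => wN; apply/eqP/val_inj.
Qed.

Lemma excursion_last m (x w : lowstate N r) :
  w.1 != ord_max -> excursion P m x w = 0%E.
Proof.
move=> wN; apply: esum1 => y _; rewrite [X in (_ * X)%E]esum1 ?mule0// => z _.
by rewrite skip_free// mule0.
Qed.

Lemma exact_corr_last (x w : lowstate N r) : w.1 != ord_max -> exact_corr P x w = 0.
Proof.
by move=> wN; rewrite /exact_corr UQDE// eseries0// => m _ _; exact: excursion_last.
Qed.

Lemma approx_corr_last M (x w : lowstate N r) : w.1 != ord_max -> approx_corr P M x w = 0.
Proof.
by move=> wN; rewrite /approx_corr UQDME// big1// => m _; exact: excursion_last.
Qed.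

Lemma cME M (x : lowstate N r) : cM P M x = \sum_w approx_corr P M x w.
Proof.
rewrite (big_last_level _ (approx_corr_last M x)); apply: eq_bigr => b _.
by rewrite mxE; case: x.
Qed.

(** As only level [N] is entered from above, [rM] counts all returns within
    [M.+1] steps. *)
Lemma rME M s : (rM P N M s)%:E = hit_by P N M s.
Proof.
have QD0 m w : (0 <= ker_mul (ker_pow (partQ P N) m) (partD P (N := N)) s w)%E.
  by apply: ker_mul_ge0 => *; [exact: Qm_ge0|exact: D_ge0].
have E : (\sum_(w : lowstate N r) ker_mul (QhatM P N M) (partD P (N := N)) s w)%E = hit_by P N M s.
  under eq_bigr do rewrite QhatMD//.
  rewrite exchange_big; apply: eq_bigr => m _ /=.
  rewrite -(esum_finType (f := ker_mul _ _ s))//.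
  transitivity (ker_app (ker_mul (ker_pow (partQ P N) m) (partD P (N := N))) (fun=> 1%E) s).
    by apply: eq_esum => w _; rewrite mule1.
  by rewrite ker_app_mul// => *; [exact: Qm_ge0|exact: D_ge0].
have last w : w.1 != ord_max -> ker_mul (QhatM P N M) (partD P (N := N)) s w = 0%E.
  by move=> wN; rewrite QhatMD// big1// => m _; apply: esum1 => y _;
    rewrite skip_free// mule0.
rewrite /rM -E big_last_level// -sumEFin; apply: eq_bigr => b _.
rewrite fineK// ge0_fin_numE; last by rewrite QhatMD// sume_ge0.
apply: (@le_lt_trans _ _ 1%E); last exact: ltry.
apply: (@le_trans _ _ (hit_by P N M s)).
  rewrite -E (bigD1 (ord_max, b))//= leeDl// sume_ge0// => w _.
  by rewrite QhatMD// sume_ge0.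
apply: absorbed_by_le1 => [*|*|]; [exact: Q_ge0|exact: exit_prob_ge0|].
exact: stay_or_exit.
Qed.

Lemma rM_01 M s : 0 <= rM P N M s <= 1.
Proof.
rewrite -!lee_fin rME; apply/andP; split.
  by apply: absorbed_by_ge0 => *; [exact: Q_ge0|exact: exit_prob_ge0].
apply: absorbed_by_le1 => [*|*|]; [exact: Q_ge0|exact: exit_prob_ge0|].
exact: stay_or_exit.
Qed.

Lemma max_rdef_ge M s : 1 - rM P N M s <= max_rdef P N M.
Proof.
apply: ub_le_sup; last by exists s.
by exists 1 => _ [t _ <-]; rewrite gerBl; case/andP: (rM_01 M t).
Qed.

(** The missing mass [cdef - cM] of a row is the probability of going up and
    making more than [M] steps there; averaging over the entrance state, it is
    at most the largest probability [1 - rM] of a long stay. *)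
Lemma cdef_le_cM_rdef M (x : lowstate N r) : cdef P x <= cM P M x + max_rdef P N M.
Proof.
set K := max_rdef P N M.
have K0 : 0 <= K.
  apply: le_trans (max_rdef_ge M (0%N, Ordinal r_gt0)); rewrite subr_ge0.
  by case/andP: (rM_01 M (0%N, Ordinal r_gt0)).
have c1 : cdef P x <= 1.
  by rewrite gerBl sumr_ge0// => j _; rewrite sumr_ge0// => b _; exact: P_ge0.
have h0 s : (0 <= hit_by P N M s)%E by rewrite -rME lee_fin; case/andP: (rM_01 M s).
rewrite -lee_fin -(U_row P_stoch).
apply: (@le_trans _ _ (ker_app (partU P (N := N)) (fun s => hit_by P N M s + K%:E)%E x)).
  apply: le_ker_app => [*|s]; first exact: U_ge0.
  by rewrite -rME -EFinD lee_fin addrC -lerBlDr max_rdef_ge.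
rewrite ker_appD//; last by move=> *; exact: U_ge0.
rewrite EFinD leeD//.
  rewrite -UQDM_row// cME -sumEFin lee_sum// => w _.
  by rewrite fineK//; exact: UQDM_fin.
rewrite [leLHS](_ : _ = K%:E * (cdef P x)%:E)%E; last first.
  rewrite -(U_row P_stoch) -esumZl// => [|y].
    by apply: eq_esum => y _; rewrite mule1 muleC.
  by rewrite mule1; exact: U_ge0.
by rewrite -EFinM lee_fin ler_piMr.
Qed.

(** The matrix [(0, ..., 0, CtildeM)], indexed by states. *)
Definition renorm_corr M (x w : lowstate N r) : R :=
  if w.1 == ord_max
  then renormalized (fun b => approx_corr P M x (ord_max, b)) (cdef P x) w.2 else 0.

Lemma sum_approx_corr_last M (x : lowstate N r) :
  \sum_b approx_corr P M x (ord_max, b) = cM P M x.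
Proof. by rewrite cME (big_last_level _ (approx_corr_last M x)). Qed.

Lemma cM_le_cdef M (x : lowstate N r) : cM P M x <= cdef P x.
Proof.
by rewrite -(sum_exact_corr P_stoch hit1) cME ler_sum// => w _; exact: approx_corr_le.
Qed.

Let f_ge0 M (x : lowstate N r) b : 0 <= approx_corr P M x (ord_max, b) :> R.
Proof. exact: approx_corr_ge0. Qed.

Let f_le M (x : lowstate N r) :
  \sum_b approx_corr P M x (ord_max, b) <= cdef P x.
Proof. by rewrite sum_approx_corr_last cM_le_cdef. Qed.

Lemma renorm_corr_ge0 M (x w : lowstate N r) : 0 <= renorm_corr M x w.
Proof. by rewrite /renorm_corr; case: ifP => // _; exact: renormalized_ge0. Qed.

Lemma sum_renorm_corr M (x : lowstate N r) : \sum_w renorm_corr M x w = cdef P x.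
Proof.
rewrite big_last_level => [|w]; last by rewrite /renorm_corr => /negPf ->.
rewrite -[RHS](sum_renormalized r_gt0 (@f_ge0 M x) (f_le M x)).
by apply: eq_bigr => b _; rewrite /renorm_corr eqxx.
Qed.

Lemma renorm_corr_gt0 M (x w : lowstate N r) : 0 < approx_corr P M x w -> 0 < renorm_corr M x w.
Proof.
case: w => j b; rewrite /renorm_corr/=; case: eqP => [->|/eqP jN].
  exact: renormalized_gt0.
by rewrite approx_corr_last// ltxx.
Qed.

(** The distance is split at the truncated correction: renormalizing adds the
    missing mass [cdef - cM], and truncating removes the same mass. *)
Lemma renorm_corr_dist M (x : lowstate N r) :
  \sum_w `|renorm_corr M x w - exact_corr P x w| <=
  (cdef P x - cM P M x) + (cdef P x - cM P M x).
Proof.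
apply: (@le_trans _ _ (\sum_w (`|renorm_corr M x w - approx_corr P M x w| +
                                 (exact_corr P x w - approx_corr P M x w)))).
  apply: ler_sum => w _; apply: le_trans (ler_distD (approx_corr P M x w) _ _) _.
  rewrite lerD2l distrC ger0_norm// subr_ge0; exact: approx_corr_le.
rewrite big_split/= sumrB (sum_exact_corr P_stoch hit1) -cME lerD2r.
rewrite big_last_level => [|w wN]; last first.
  by rewrite /renorm_corr (negPf wN) approx_corr_last// subr0 normr0.
rewrite -sum_approx_corr_last.
rewrite -(renormalized_dist r_gt0 (@f_ge0 M x) (f_le M x)).
by apply: ler_sum => b _; rewrite /renorm_corr/= eqxx.
Qed.

Lemma partTE s t : partT P N s t = P (lowst s).1 (lowst t).1 (lowst s).2 (lowst t).2.
Proof. by rewrite mxE. Qed.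

Lemma censoredE s t : censored P N s t =
  P (lowst s).1 (lowst t).1 (lowst s).2 (lowst t).2 + exact_corr P (lowst s) (lowst t).
Proof. by rewrite !mxE. Qed.

Lemma last_col_renorm_corr M s t :
  last_col (CtildeM P N M) s t = renorm_corr M (lowst s) (lowst t).
Proof.
rewrite last_colE /renorm_corr; case: eqP => // _; rewrite !mxE.
by rewrite /renormalized sum_approx_corr_last.
Qed.

Lemma last_col_Cinf s t : last_col (Cinf P N) s t = exact_corr P (lowst s) (lowst t).
Proof.
rewrite last_colE; case: eqP => [e|/eqP /exact_corr_last ->//]; rewrite !mxE.
by rewrite /exact_corr -e.
Qed.

Lemma racmE M s t : racm P N M s t =
  P (lowst s).1 (lowst t).1 (lowst s).2 (lowst t).2 +
  renorm_corr M (lowst s) (lowst t).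
Proof. by rewrite mxE partTE last_col_renorm_corr. Qed.

Lemma DeltaE M : Delta P N M = last_col (CtildeM P N M - Cinf P N).
Proof.
apply/matrixP => s t; rewrite last_colB /Delta.
rewrite [LHS]mxE [X in _ + X = _]mxE racmE censoredE.
rewrite [RHS]mxE [X in _ = _ + X]mxE last_col_renorm_corr last_col_Cinf.
by rewrite opprD addrACA subrr add0r.
Qed.

Lemma stochastic_completion (X : 'M[R]_(lowdim N r)) (c : lowstate N r -> lowstate N r -> R) :
  (forall s t, X s t = P (lowst s).1 (lowst t).1 (lowst s).2 (lowst t).2 +
                       c (lowst s) (lowst t)) ->
  (forall x w, 0 <= c x w) -> (forall x, \sum_w c x w = cdef P x) ->
  mx_stochastic X.
Proof.
move=> XE c0 c1; split=> [s t|s]; first by rewrite XE addr_ge0// P_ge0.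
under eq_bigr do rewrite XE.
rewrite (sum_lowst (fun w => P (lowst s).1 w.1 (lowst s).2 w.2 + c (lowst s) w)).
rewrite big_split/= c1.
rewrite -(pair_bigA _ (fun (j : 'I_N.+1) (b : 'I_r) =>
  P (lowst s).1 j (lowst s).2 b))/=.
by rewrite /cdef addrC subrK.
Qed.

Lemma censored_stochastic : mx_stochastic (censored P N).
Proof.
apply: stochastic_completion censoredE _ (sum_exact_corr P_stoch hit1) => x w.
by rewrite fine_ge0//; exact: UQD_ge0.
Qed.

Lemma racm_stochastic M : mx_stochastic (racm P N M).
Proof.
exact: stochastic_completion (racmE M) (renorm_corr_ge0 M) (sum_renorm_corr M).
Qed.

Lemma Delta_rowsum M s :
  \sum_t `|Delta P N M s t| <=
  (cdef P (lowst s) - cM P M (lowst s)) + (cdef P (lowst s) - cM P M (lowst s)).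
Proof.
rewrite (le_trans _ (renorm_corr_dist M (lowst s)))//.
rewrite -(sum_lowst (fun w => `|renorm_corr M (lowst s) w - exact_corr P (lowst s) w|)).
apply: ler_sum => t _; rewrite DeltaE last_colB.
by rewrite [X in `|X|]mxE [X in _ + X]mxE last_col_renorm_corr last_col_Cinf.
Qed.

(** Of the two equal terms in [Delta_rowsum], one is bounded through
    [max_cdiff] and the other one through [max_rdef]. *)
Lemma maxrowsum_Delta_le M :
  maxrowsum (Delta P N M) <= max_cdiff P N M + max_rdef P N M.
Proof.
apply: bigmaxr_le => [|s].
  apply: addr_ge0; first exact: bigmaxr_ge0.
  apply: le_trans (max_rdef_ge M (0%N, Ordinal r_gt0)); rewrite subr_ge0.
  by case/andP: (rM_01 M (0%N, Ordinal r_gt0)).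
apply: le_trans (Delta_rowsum M s) _; apply: lerD.
  apply: le_trans (ler_norm _) _.
  exact: (le_bigmaxr (fun x : lowstate N r => `|cdef P x - cM P M x|)).
by rewrite lerBlDl cdef_le_cM_rdef.
Qed.

(** The limit does not follow from [maxrowsum_Delta_le], because [max_rdef] does
    not tend to 0; here both terms in [Delta_rowsum] are kept as [cdef - cM],
    which tends to 0 since the excursions exhaust [cdef]. *)
Lemma maxrowsum_Delta_cvg : maxrowsum (Delta P N M) @[M --> \oo] --> (0 : R).
Proof.
pose e M (x : lowstate N r) := cdef P x - cM P M x.
have e0 M x : 0 <= e M x by rewrite subr_ge0 cM_le_cdef.
have e_cvg x : e M x @[M --> \oo] --> (0 : R).
  rewrite -(subrr (cdef P x)); apply: cvgB; first exact: cvg_cst.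
  rewrite -(sum_exact_corr P_stoch hit1).
  rewrite (_ : (fun M => cM P M x) = (fun M => \sum_w approx_corr P M x w)); last first.
    by apply/funext => M; rewrite cME.
  by apply: (cvg_big add_continuous) => w _; exact: approx_corr_cvg.
have : (\sum_x (e M x + e M x)) @[M --> \oo] --> (0 : R).
  rewrite [X in _ --> X](_ : _ = \sum_(x : lowstate N r) (0 + 0) :> R); last first.
    by rewrite big1// => x _; rewrite addr0.
  by apply: (cvg_big add_continuous) => x _; exact: cvgD.
move=> e_sum; apply: (squeeze_cvgr _ (cvg_cst 0) e_sum).
near=> M; rewrite maxrowsum_ge0/=; apply: bigmaxr_le => [|s].
  by rewrite sumr_ge0// => x _; rewrite addr_ge0.
apply: le_trans (Delta_rowsum M s) _.
rewrite (bigD1 (lowst s))//= lerDl sumr_ge0// => x _; exact: addr_ge0.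
Unshelve. all: by end_near. Qed.

End MG1Censoring.

(** * Irreducibility by deleting excursions *)

Section Irreducibility.
Context {R : realType} {r : nat}.
Variables (P : nat -> nat -> 'M[R]_r) (N : nat).
Hypothesis P_stoch : ker_stochastic (block_ker P).
Hypothesis P_irr : ker_irreducible (block_ker P).
Hypothesis hit1 : forall s, hit P N s = 1%E.

Definition reaches n (X : 'M[R]_n) s t := exists k : nat, 0 < (X ^+ k) s t.

(** From [y] above level [N], the lower levels can be entered at [w]. *)
Definition can_exit (y : state r) (w : lowstate N r) :=
  exists k, (0 < ker_mul (ker_pow (partQ P N) k) (partD P (N := N)) y w)%E.

Lemma can_exit_now y w : (0 < partD P y w)%E -> can_exit y w.
Proof.
move=> Dyw; exists 0%N; apply: ker_mul_gt0 Dyw => [*|*|].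
- exact: Qm_ge0.
- exact: D_ge0.
- by rewrite /= /ker_id eqxx lte01.
Qed.

Lemma can_exit_later y y' w :
  (0 < partQ P N y y')%E -> can_exit y' w -> can_exit y w.
Proof.
move=> Qy [k /ker_mul_gt0_ex[*|*|v [Qv Dv]]]; [exact: Qm_ge0|exact: D_ge0|].
exists k.+1; apply: ker_mul_gt0 Dv => [*|*|].
- exact: Qm_ge0.
- exact: D_ge0.
- by apply: ker_mul_gt0 Qy Qv => *; [exact: Q_ge0|exact: Qm_ge0].
Qed.

Lemma exact_corr_gt0 x y w : (0 < partU P x y)%E -> can_exit y w -> 0 < exact_corr P x w.
Proof.
move=> Uxy [k QDk]; have QD0 m z v :
    (0 <= ker_mul (ker_pow (partQ P N) m) (partD P (N := N)) z v)%E.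
  by apply: ker_mul_ge0 => *; [exact: Qm_ge0|exact: D_ge0].
have e0 : (0 < excursion P k x w)%E.
  by apply: ker_mul_gt0 Uxy QDk => // *; exact: U_ge0.
rewrite -lte_fin fineK ?(UQD_fin P_stoch hit1)//; apply: lt_le_trans e0 _.
rewrite UQDE// nneseries_esumT => [|m]; last exact: excursion_ge0.
by apply: esum_ge_term => // m _; exact: excursion_ge0.
Qed.

Variable X : 'M[R]_(lowdim N r).
Hypothesis X_ge0 : forall s t, 0 <= X s t.
Hypothesis PX : forall s t,
  0 < P (lowst s).1 (lowst t).1 (lowst s).2 (lowst t).2 -> 0 < X s t.
Hypothesis CX : forall s t, 0 < exact_corr P (lowst s) (lowst t) -> 0 < X s t.

Lemma reaches_step s u t : 0 < X s u -> reaches X u t -> reaches X s t.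
Proof.
move=> su [k ut]; exists k.+1; rewrite exprS mxE (bigD1 u)//= ltr_pwDl ?mulr_gt0//.
by rewrite sumr_ge0// => i _; rewrite mulr_ge0// expmx_ge0.
Qed.

(** Induction on the length of a path of positive probability to [t]. Deleting
    its stretches above level [N] leaves a path for [X]: the steps between lower
    states are covered by [PX], and an excursion by [CX]. *)
Lemma path_reaches t m z : (0 < ker_pow (block_ker P) m z (low (lowst t)))%E ->
  (forall s, z = low (lowst s) -> reaches X s t) /\
  (forall y, z = high N y -> exists2 u, can_exit y (lowst u) & reaches X u t).
Proof.
have [idx _ idxK] := @lowst_bij N r.
have B0 z1 z2 : (0 <= block_ker P z1 z2)%E by exact: P_stoch.1.
elim: m z => [|m IH] z.
  rewrite /= /ker_id; case: eqP => [->|]; last by rewrite ltxx.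
  move=> _; split=> [s /low_inj/(bij_inj lowst_bij) <-|y /low_neq_high//].
  by exists 0%N; rewrite expr0 mxE eqxx.
move=> /ker_mul_gt0_ex[//|*|z' [Pzz' /IH[IHlow IHhigh]]].
  exact: ker_pow_ge0.
have [[x ez']|[y' ez']] := low_or_high N z'; subst z'.
  rewrite -[x]idxK in Pzz' IHlow *; have xt := IHlow _ erefl.
  split=> [s ez|y ez]; subst z.
    by apply: reaches_step xt; apply: PX; rewrite -lte_fin.
  by exists (idx x) => //; exact: can_exit_now.
have [u y'u ut] := IHhigh _ erefl; split=> [s ez|y ez]; subst z.
  by apply: reaches_step ut; apply: CX; exact: exact_corr_gt0 Pzz' y'u.
by exists u => //; exact: can_exit_later Pzz' y'u.
Qed.

(** This applies both to the censored matrix and, once the truncated correction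
    has the same support as the full one, to its approximations. *)
Lemma irreducible_completion : mx_irreducible X.
Proof.
move=> s t; have [m Pm] := P_irr (low (lowst s)) (low (lowst t)).
exact: (path_reaches Pm).1.
Qed.

End Irreducibility.

(** * Perturbation bound and convergence *)

Theorem theorem5p3 (R : realType) (r : nat) (r_ge1 : (1 <= r)%N)
  (P : nat -> nat -> 'M[R]_r) (pi : nat * 'I_r -> R) (N : nat)
  (P_mg1 : mg1_type P)
  (P_stoch : ker_stochastic (block_ker P))
  (P_irr : ker_irreducible (block_ker P))
  (P_posrec : ker_positive_recurrent (block_ker P))
  (pi_stat : ker_stationary (block_ker P) pi) :
  (exists! piN, mx_stationary (censored P N) piN) /\
  (exists M0 : nat, forall M, (M0 <= M)%N -> mx_irreducible (racm P N M)) /\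
  (forall M0 : nat,
    (forall M, (M0 <= M)%N -> mx_irreducible (racm P N M)) ->
    (forall M, (M0 <= M)%N ->
       exists! pit, mx_stationary (racm P N M) pit) /\
    (forall piN (pit : nat -> 'rV[R]_(\sum_(i < N.+1) r)),
      mx_stationary (censored P N) piN ->
      (forall M, (M0 <= M)%N -> mx_stationary (racm P N M) (pit M)) ->
      let n := (N.+1 * r)%N in
      let Z := invmx (fundamental P piN) in
      fundamental P piN \in unitmx /\
      (norm1 (pit M - piN) @[M --> \oo] --> (0 : R)) /\
      (forall M, (M0 <= M)%N ->
        let D := Delta P N M in
        let dC := CtildeM P N M - Cinf P N in
        D = last_col dC /\
        norm1 (pit M - piN) <= opnorm1 D * opnorm1 Z /\
        opnorm_sup D = opnorm_sup dC /\
        opnorm_sup D <= max_cdiff P N M + max_rdef P N M /\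
        opnorm1 D = opnorm1 dC /\
        opnorm1 D <= n%:R * opnorm_sup D /\
        norm1 (pit M - piN) <=
          opnorm1 Z * (n%:R * (max_cdiff P N M + max_rdef P N M))))).
Proof.
have hit1 := @hit_eq1 R r P N P_stoch pi r_ge1 P_irr pi_stat.
have n0 : (0 < lowdim N r)%N by rewrite sum_nat_const card_ord muln_gt0.
have cens_stoch := censored_stochastic P_stoch hit1.
have racm_stoch := racm_stochastic r_ge1 P_mg1 P_stoch hit1.
have C0 x w : 0 <= exact_corr P x w :> R by rewrite fine_ge0//; exact: UQD_ge0.
have cens_irr : mx_irreducible (censored P N).
  apply: (irreducible_completion P_stoch P_irr hit1) => [|s t Pst|s t Cst].
  - exact: cens_stoch.1.
  - by rewrite censoredE ltr_pwDl.
  - by rewrite censoredE ltr_wpDl// P_ge0.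
split; first exact: mx_stationary_exists_unique.
split.
  have [M0 _ supp] : \forall M \near \oo, forall xw : lowstate N r * lowstate N r,
      0 < exact_corr P xw.1 xw.2 -> 0 < approx_corr P M xw.1 xw.2.
    apply: filter_forall => -[x w] /=.
    have [Cxw|Cxw] := ltP 0 (exact_corr P x w); last by near=> M.
    have h : \forall M \near \oo, 0 < approx_corr P M x w.
      by apply: (@cvgr_gt R nat _ _ _ (exact_corr P x w)) Cxw; exact: approx_corr_cvg.
    by near=> M => _; near: M.
  exists M0 => M /supp suppM.
  apply: (irreducible_completion P_stoch P_irr hit1) => [|s t Pst|s t Cst].
  - exact: (racm_stoch M).1.
  - rewrite racmE// ltr_pwDl//; exact: renorm_corr_ge0.
  - rewrite racmE// ltr_wpDl ?P_ge0//; apply: renorm_corr_gt0 => //.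
    exact: (suppM (_, _)).
move=> M0 irr; split=> [M MM0|piN pit piN_stat pit_stat n Z].
  by apply: mx_stationary_exists_unique => //; exact: irr.
have bound M : (M0 <= M)%N ->
    norm1 (pit M - piN) <= opnorm1 (Delta P N M) * opnorm1 Z.
  move=> MM0; exact: (stationary_perturbation cens_stoch cens_irr piN_stat
    (pit_stat M MM0)).
have Z0 : 0 <= opnorm1 Z by rewrite opnorm1E maxrowsum_ge0.
have n1 : 1 <= n%:R :> R by rewrite ler1n muln_gt0.
split; first exact: fundamental_unitmx.
split.
  have D0 : maxrowsum (Delta P N M) * opnorm1 Z @[M --> \oo] --> (0 : R).
    rewrite -(mul0r (opnorm1 Z)); apply: cvgM; last exact: cvg_cst.
    exact: maxrowsum_Delta_cvg.
  apply: (squeeze_cvgr _ (cvg_cst 0) D0).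
  near=> M; rewrite norm1_ge0 -opnorm1E/= bound//.
  by near: M; exact: nbhs_infty_ge.
move=> M MM0 D dC.
have DE : D = last_col dC by exact: DeltaE.
have D_le : maxrowsum D <= max_cdiff P N M + max_rdef P N M.
  exact: maxrowsum_Delta_le.
have D_dC : maxrowsum D = maxrowsum dC by rewrite DE maxrowsum_last_col.
have nD : maxrowsum D <= n%:R * maxrowsum D by rewrite ler_peMl// maxrowsum_ge0.
rewrite !opnorm_supE ![opnorm1 D]opnorm1E [opnorm1 dC]opnorm1E.
do !split=> //; first by rewrite -opnorm1E; exact: bound.
apply: le_trans (bound M MM0) _; rewrite mulrC ler_wpM2l// opnorm1E.
by apply: le_trans nD _; rewrite ler_wpM2l// (le_trans ler01).
Unshelve. all: by end_near. Qed.
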